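(* Let $\mathcal{O}$ be a Euclidean oriented matroid on the ground set $E$, and let $\mathcal{O}\cup p=\mathcal{O}[e_1^{\alpha_1},\dots,e_k^{\alpha_k}]$ be a lexicographic extension of $\mathcal{O}$ in which $p$ is not a loop. Let $f\in E$ be an element that is not a coloop of $\mathcal{O}\cup p$. Then the oriented matroid program $(\mathcal{O}\cup p,p,f)$ is Euclidean.
   Context: Let $\mathcal{O}$ be an oriented matroid of rank $r$ on a finite ground set $E$, given by its set of cocircuits (sign vectors in $\{+,-,0\}^E$). For sign vectors $X,Y$: $\operatorname{supp}(X)=\{e:X_e\neq 0\}$, $z(X)=E\setminus\operatorname{supp}(X)$, $\operatorname{sep}(X,Y)=\{e: X_e=-Y_e\neq 0\}$, $(X\circ Y)_e=X_e$ if $X_e\neq 0$ and $(X\circ Y)_e=Y_e$ otherwise; $X,Y$ are conformal if $\operatorname{sep}(X,Y)=\emptyset$. $\mathcal{M}(\mathcal{O})$ is the underlying matroid. An edge is a covector $F$ whose zero set $z(F)$ is a flat of rank $r-2$ of $\mathcal{M}(\mathcal{O})$. Two cocircuits $X\neq\pm Y$ are comodular if $X\circ Y$ is an edge. For comodular cocircuits $X,Y$ and $e\in\operatorname{sep}(X,Y)$ there is a unique cocircuit $Z$ with $Z_e=0$ and $Z_h=(X\circ Y)_h$ for all $h\notin\operatorname{sep}(X,Y)$ (''cocircuit elimination of $e$ between $X$ and $Y$''). An oriented matroid program is a triple $(\mathcal{O},g,f)$ with $g\neq f\in E$, $g$ not a loop, $f$ not a coloop. For comodular cocircuits $X,Y$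 with $X_g=Y_g\neq 0$ let $Z$ be obtained by eliminating $g$ between $-X$ and $Y$; write $X\to_{g,f}Y$ if $Z_f=+$, $X\leftarrow_{g,f}Y$ if $Z_f=-$, and $X\leftrightarrow_{g,f}Y$ (undirected) if $Z_f=0$. The cocircuit graph $G_f$ of $(\mathcal{O},g,f)$ has as vertices the cocircuits $X$ with $X_g=+$ and as edges the pairs $\{X,Y\}$ of conformal comodular such cocircuits, oriented as just described. A directed cycle in $G_f$ is a sequence $P^1,\dots,P^n=P^1$ of vertices with $P^1,\dots,P^{n-1}$ pairwise distinct, $\{P^i,P^{i+1}\}$ an edge, $P^i\to P^{i+1}$ or $P^i\leftrightarrow P^{i+1}$ for all $i$, and $P^i\to P^{i+1}$ for at least one $i$. The program is Euclidean if $G_f$ has no directed cycle. An oriented matroid $\mathcal{O}$ is Euclidean if every oriented matroid program $(\mathcal{O},g,f)$ is Euclidean. A single-element extension $\mathcal{O}\cup p$ is determined by a localization $\sigma$ (a map from cocircuits of $\mathcal{O}$ to $\{+,-,0\}$); its cocircuits are the old cocircuits $(Y,\sigma(Y))$, $Y$ a cocircuit of $\mathcal{O}$, and the new cocircuits $(Y^1\circ Y^2,0)$ with $Y^1,Y^2$ conformal comodular cocircuits of $\mathcal{O}$ with $\sigma(Y^1)=-\sigma(Y^2)\neq 0$. For an ordered subset $I=[e_1,\dots,e_k]$ of $E$, the index of a cocircuit $Y$ with respect to $I$ is the smallest $i$ with $Y_{e_i}\neq 0$, or $k+1$ if there is none. For $\alpha\in\{+,-\}^k$, the lexicographic extension $\mathcal{O}[e_1^{\alpha_1},\dots,e_k^{\alpha_k}]=\mathcal{O}\cup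 p$ is the single-element extension with localization $\sigma(Y)=\alpha_iY_{e_i}$ if the index $i$ of $Y$ is $\le k$, and $\sigma(Y)=0$ otherwise. *)

(* Defs.v *)
From mathcomp Require Import all_boot.
Set Implicit Arguments. Unset Strict Implicit. Unset Printing Implicit Defensive.

(* Signs: None = 0, Some true = +, Some false = -.
   Sign vectors on a finite ground set E: {ffun E -> option bool}. *)
Notation svec E := {ffun E -> option bool}.

Section OM.
Variable E : finType.

Definition sv0 : svec E := [ffun _ => None].
Definition svopp (X : svec E) : svec E := [ffun e => omap negb (X e)].
Definition svcomp (X Y : svec E) : svec E :=
  [ffun e => if X e is Some b then Some b else Y e].
Definition supp (X : svec E) : {set E} := [set e | X e != None].
Definition zer (X : svec E) : {set E} := [set e | X e == None].
Definition sep (X Y : svec E) : {set E} :=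
  [set e | (X e != None) && (X e == omap negb (Y e))].
Definition conformal (X Y : svec E) : bool := sep X Y == set0.

(* Cocircuit axioms of an oriented matroid (Bjorner et al.) *)
Definition is_OM (C : {set svec E}) : Prop :=
  [/\ sv0 \notin C,
      forall X, X \in C -> svopp X \in C,
      forall X Y, X \in C -> Y \in C -> supp X \subset supp Y ->
        X = Y \/ X = svopp Y &
      forall X Y e, X \in C -> Y \in C -> X <> svopp Y -> e \in sep X Y ->
        exists2 Z, Z \in C &
          [/\ Z e = None,
              forall h, Z h = Some true -> X h = Some true \/ Y h = Some true &
              forall h, Z h = Some false -> X h = Some false \/ Y h = Some false]].

(* Covectors: all compositions of cocircuits (including the empty one, 0),
   obtained as the least fixpoint of L |-> {0} u {Y o F | Y in C, F in L}. *)
Definition covec_step (C : {set svec E}) (L : {set svec E}) : {set svec E} :=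
  sv0 |: [set svcomp Y F | Y in C, F in L].
Definition covectors (C : {set svec E}) : {set svec E} := fixset (covec_step C).

(* Underlying matroid M(O): its cocircuits are the supports of the cocircuits
   of O.  corank = rank function of the dual matroid M* (independent sets of
   M* = sets containing no cocircuit of M); the rank of M is obtained by the
   duality formula r(A) = |A| + r*(E\A) - r*(E). *)
Definition coindep (C : {set svec E}) (T : {set E}) : bool :=
  [forall Y in C, ~~ (supp Y \subset T)].
Definition corank (C : {set svec E}) (S : {set E}) : nat :=
  \max_(T : {set E} | (T \subset S) && coindep C T) #|T|.
Definition mrank (C : {set svec E}) (A : {set E}) : nat :=
  #|A| + corank C (~: A) - corank C setT.
Definition rankOM (C : {set svec E}) : nat := mrank C setT.

Definition is_loop (C : {set svec E}) (e : E) : bool := [forall Y in C, Y e == None].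
Definition is_coloop (C : {set svec E}) (e : E) : bool :=
  [exists Y in C, supp Y == [set e]].

Definition is_edge (C : {set svec E}) (F : svec E) : bool :=
  (F \in covectors C) && (mrank C (zer F) + 2 == rankOM C).
Definition comodular (C : {set svec E}) (X Y : svec E) : bool :=
  [&& X \in C, Y \in C, X != Y, X != svopp Y & is_edge C (svcomp X Y)].

Definition elim_of (C : {set svec E}) (X Y : svec E) (e : E) (Z : svec E) : Prop :=
  [/\ Z \in C, Z e = None & forall h, h \notin sep X Y -> Z h = svcomp X Y h].

Definition arrow_sign (C : {set svec E}) (g f : E) (X Y : svec E) (s : option bool) : Prop :=
  exists Z, elim_of C (svopp X) Y g Z /\ Z f = s.

Definition vertex (C : {set svec E}) (g : E) (X : svec E) : bool :=
  (X \in C) && (X g == Some true).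
Definition gedge (C : {set svec E}) (g : E) (X Y : svec E) : bool :=
  [&& vertex C g X, vertex C g Y, conformal X Y & comodular C X Y].
Definition darc (C : {set svec E}) (g f : E) (X Y : svec E) : Prop :=
  gedge C g X Y /\ arrow_sign C g f X Y (Some true).
Definition uarc (C : {set svec E}) (g f : E) (X Y : svec E) : Prop :=
  gedge C g X Y /\ arrow_sign C g f X Y None.

(* s = [P^1; ...; P^(n-1)], with P^n = P^1 *)
Definition directed_cycle (C : {set svec E}) (g f : E) (s : seq (svec E)) : Prop :=
  [/\ s != [::], uniq s,
      forall i, i < size s ->
        darc C g f (nth sv0 s i) (nth sv0 s (i.+1 %% size s)) \/
        uarc C g f (nth sv0 s i) (nth sv0 s (i.+1 %% size s)) &
      exists2 i, i < size s &
        darc C g f (nth sv0 s i) (nth sv0 s (i.+1 %% size s))].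

Definition is_program (C : {set svec E}) (g f : E) : Prop :=
  [/\ g != f, ~~ is_loop C g & ~~ is_coloop C f].
Definition euclidean_program (C : {set svec E}) (g f : E) : Prop :=
  ~ exists s, directed_cycle C g f s.
Definition euclidean_OM (C : {set svec E}) : Prop :=
  is_OM C /\ forall g f, is_program C g f -> euclidean_program C g f.

(* single-element extension O u p on the ground set option E (p = None) *)
Definition ext_sv (X : svec E) (s : option bool) : svec (option E) :=
  [ffun o => if o is Some e then X e else s].
Definition single_ext (C : {set svec E}) (sigma : svec E -> option bool)
  : {set svec (option E)} :=
  [set ext_sv Y (sigma Y) | Y in C] :|:
  [set ext_sv (svcomp Y1 Y2) None | Y1 in C, Y2 in C &
     [&& conformal Y1 Y2, comodular C Y1 Y2, sigma Y1 != None &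
         sigma Y1 == omap negb (sigma Y2)]].

(* lexicographic localization for I = [:: (e_1, a_1); ...; (e_k, a_k)],
   a_i = true meaning alpha_i = + : sigma(Y) = alpha_i Y_{e_i} for the index
   i of Y, and 0 if Y vanishes on all e_i *)
Fixpoint lex_sigma (I : seq (E * bool)) (Y : svec E) : option bool :=
  match I with
  | [::] => None
  | (e, a) :: I' => if Y e is Some b then Some (if a then b else ~~ b)
                    else lex_sigma I' Y
  end.
Definition lex_ext (C : {set svec E}) (I : seq (E * bool)) : {set svec (option E)} :=
  single_ext C (lex_sigma I).

End OM.

(* Main.v *)
Require Import Defs.
From mathcomp Require Import all_boot zify.
Set Implicit Arguments. Unset Strict Implicit. Unset Printing Implicit Defensive.

(** Restricting a directed cycle of [(O u p, p, f)] to [E] gives a cyclic sequence of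
    cocircuits of [O], consecutive ones being conformal and comodular in [O].  Along it
    the entry at [f] is a constant sign [c <> 0].  Let [e] be the first element of [I]
    that does not vanish identically on the cycle.  Near a cocircuit with zero [e]-entry
    the arrows are dictated by [c], so that the cycle cannot both leave and enter
    [e = 0]; hence [e] has a constant nonzero sign on the cycle.

    On an edge [{X, Y}] let [Z] and [W] be obtained by eliminating [p], resp. [e],
    between [-X] and [Y].  As [p] is a perturbation of [e], either [Z = W] or
    [Z = W o V] with [V] of opposite sign to [W] at [p].  So [W f] is nonnegative all
    along the cycle, and vanishes because [(O, e, f)] is Euclidean.  Then [f] and [e] are
    parallel on each line, and the sign of [Z f] becomes a constant multiple of that of
    [W] at [p], which is computed lexicographically from the remaining elements of [I].
    Euclideanness of [(O, e, h)] for these elements [h], one after the other, shows that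
    all of them vanish on every [W]; thus [Z = W] and [Z f = 0] on every edge. *)

(** * Sign vectors: supports, opposites and conformality *)

Section SignVectors.
Variable E : finType.
Implicit Types (X Y V W : svec E) (D : {set E}) (e h x : E).

Definition parallel X Y := (X == Y) || (X == svopp Y).

Lemma svoppK : involutive (@svopp E).
Proof. by move=> X; apply/ffunP=> e; rewrite !ffunE; case: (X e) => [[]|]. Qed.

Lemma supp_svopp X : supp (svopp X) = supp X.
Proof. by apply/setP=> e; rewrite !inE ffunE; case: (X e). Qed.

Lemma suppPn X e : reflect (X e = None) (e \notin supp X).
Proof. by rewrite inE negbK; apply: eqP. Qed.

Lemma supp_svcomp X Y : supp (svcomp X Y) = supp X :|: supp Y.
Proof. by apply/setP=> e; rewrite !inE ffunE; case: (X e). Qed.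

Lemma supp_subP X D : reflect (forall e, e \notin D -> X e = None) (supp X \subset D).
Proof.
apply: (iffP idP) => [/subsetP sXD e eD|H].
  by apply/suppPn; apply: contraNN eD; apply: sXD.
by apply/subsetP=> e; apply: contraLR => /H /suppPn.
Qed.

Lemma parallel_sym X Y : parallel X Y = parallel Y X.
Proof. by rewrite /parallel eq_sym -(inv_eq svoppK X) [svopp X == Y]eq_sym. Qed.

Lemma parallel_oppr X Y : parallel X (svopp Y) = parallel X Y.
Proof. by rewrite /parallel svoppK orbC. Qed.

Lemma parallel_None X Y e : parallel X Y -> X e = None -> Y e = None.
Proof. by case/orP=> /eqP->; rewrite ?ffunE //; case: (Y e). Qed.

Lemma conformalP X Y :
  reflect (forall e, X e != None -> Y e != None -> X e = Y e) (conformal X Y).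
Proof.
apply: (iffP eqP) => [s0 e|H]; last first.
  apply/setP=> e; rewrite !inE; have := H e.
  by case: (X e) => [[]|] //; case: (Y e) => [[]|] //= /(_ isT isT).
move/setP/(_ e): s0; rewrite !inE.
by case: (X e) => [[]|] //; case: (Y e) => [[]|].
Qed.

Lemma conformal_sym X Y : conformal X Y = conformal Y X.
Proof. by apply/conformalP/conformalP => H e a b; rewrite (H e). Qed.

Lemma svcompC X Y : conformal X Y -> svcomp X Y = svcomp Y X.
Proof.
move/conformalP=> H; apply/ffunP=> e; rewrite !ffunE; have := H e.
by case: (X e) => [a|]; case: (Y e) => [b|] // ->.
Qed.

End SignVectors.

(** * Elimination, lines and corank in the underlying matroid *)

Section Cocircuits.
Variables (E : finType) (C : {set svec E}).
Hypothesis OM : is_OM C.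
Implicit Types (X Y V W : svec E) (D T : {set E}) (e h x : E).

Let C0 : sv0 E \notin C. Proof. by case: OM. Qed.
Let Copp X : X \in C -> svopp X \in C. Proof. by case: OM => _ H _ _; apply: H. Qed.

Lemma cocircuit_incomparable X Y :
  X \in C -> Y \in C -> supp X \subset supp Y -> parallel X Y.
Proof.
case: OM => _ _ H _ XC YC /(H _ _ XC YC) [->|->]; by rewrite /parallel eqxx ?orbT.
Qed.

Lemma cocircuit_neq0 X : X \in C -> exists e, X e != None.
Proof.
move=> XC; case: (pickP (mem (supp X))) => [e|X0]; first by rewrite !inE; exists e.
case/negP: C0; suff -> : sv0 E = X by [].
apply/ffunP=> e; rewrite ffunE; apply/esym/suppPn.
by move: (X0 e) => /= ->.
Qed.

Lemma cocircuit_elim X Y e : X \in C -> Y \in C -> ~~ parallel X Y ->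
  X e != None -> X e = omap negb (Y e) ->
  exists2 Z, Z \in C & Z e = None /\ forall h, [\/ Z h = None, Z h = X h | Z h = Y h].
Proof.
move=> XC YC nXY Xe XYe; case: OM => _ _ _ /(_ X Y e XC YC) [||Z ZC [Ze Zp Zm]].
- by move=> eXY; rewrite /parallel eXY eqxx orbT in nXY.
- by rewrite inE Xe XYe eqxx.
exists Z => //; split=> // h; case Zh: (Z h) => [[]|]; last by constructor.
  by case: (Zp h Zh) => <-; [constructor 2|constructor 3].
by case: (Zm h Zh) => <-; [constructor 2|constructor 3].
Qed.

(** Unsigned elimination: passing to the opposite of [Y] if necessary makes [e] separate the two
    cocircuits. *)
Lemma cocircuit_avoid X Y e : X \in C -> Y \in C -> ~~ parallel X Y ->
  exists V, [/\ V \in C, supp V \subset supp X :|: supp Y & V e = None].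
Proof.
move=> XC YC nXY.
case Xe: (X e) => [a|]; last by exists X; split=> //; apply: subsetUl.
case Ye: (Y e) => [b|]; last by exists Y; split=> //; apply: subsetUr.
pose Y' := if a == b then svopp Y else Y.
have Y'C : Y' \in C by rewrite /Y'; case: ifP => // _; apply: Copp.
have sY' : supp Y' = supp Y by rewrite /Y'; case: ifP => // _; rewrite supp_svopp.
case: (@cocircuit_elim X Y' e) => //.
- by rewrite /Y'; case: ifP => // _; rewrite parallel_oppr.
- by rewrite Xe.
- rewrite /Y' Xe; case: eqP => [->|ab]; rewrite ?ffunE Ye /= ?negbK //.
  by move: ab; case: (a); case: (b).
move=> Z ZC [Ze Zh]; exists Z; split=> //; rewrite -sY'; apply/supp_subP=> h.
rewrite inE negb_or => /andP[/suppPn hX /suppPn hY].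
by case: (Zh h) => ->.
Qed.

(** Strong elimination from weak, by induction on the size of the union. If the first [V] loses [x],
    some [y] of [V] outside [X] is eliminated between [Y] and [V] keeping [e]; the result [W] is
    then eliminated with [X] at [e]. The first union misses [x], the second misses [y]. *)
Lemma cocircuit_strong_avoid X Y e x : X \in C -> Y \in C ->
  X e != None -> Y e != None -> X x != None -> Y x = None ->
  exists V, [/\ V \in C, supp V \subset supp X :|: supp Y, V e = None & V x != None].
Proof.
have [n] := ubnP #|supp X :|: supp Y|.
elim: n X Y e x => // n IH X Y e x /ltnSE-len XC YC Xe Ye Xx Yx.
have npar (A B : svec E) h : A h != None -> B h = None -> ~~ parallel A B.
  by move=> Ah Bh; apply: contraNN Ah; rewrite parallel_sym => /parallel_None->.
have [V [VC sV Ve]] := cocircuit_avoid e XC YC (npar _ _ _ Xx Yx).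
case Vx: (V x) => [v|]; first by exists V; rewrite Vx.
have [y] : exists y, (V y != None) && (X y == None).
  apply/existsP; apply: contraNT (npar _ _ _ Xe Ve) => /existsPn H.
  rewrite parallel_sym cocircuit_incomparable //; apply/subsetP=> y; rewrite !inE => Vy.
  by move: (H y); rewrite Vy.
case/andP=> Vy /eqP Xy.
have Yy : Y y != None.
  by move/subsetP: sV => /(_ y); rewrite !inE Vy Xy => /(_ isT).
have [|W [WC sW Wy We]] := IH Y V y e _ YC VC Yy Vy Ye Ve.
  apply: leq_trans len; apply/proper_card/properP; split.
    by rewrite subUset sV subsetUr.
  by exists x; rewrite !inE ?Xx // Yx Vx.
have Wx : W x = None.
  by move/supp_subP: sW; apply; rewrite !inE Yx Vx.
have sWXY : supp W \subset supp X :|: supp Y.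
  by apply: subset_trans sW _; rewrite subUset sV subsetUr.
have [|Z [ZC sZ Ze Zx]] := IH X W e x _ XC WC Xe We Xx Wx.
  apply: leq_trans len; apply/proper_card/properP; split.
    by rewrite subUset sWXY subsetUl.
  by exists y; rewrite !inE ?Yy ?orbT // Xy Wy.
exists Z; split=> //; apply: subset_trans sZ _.
by rewrite subUset sWXY subsetUl.
Qed.

(* The cocircuits supported in [D] form a line: the contraction of the
   complement of [D] has rank two. *)
Definition line D := forall x V W, x \in D -> V \in C -> W \in C ->
  supp V \subset D -> supp W \subset D -> V x = None -> W x = None -> parallel V W.

(** Two nonparallel cocircuits vanishing at [x] would give [V3] with [V3 a = 0]. A cocircuit [W]
    through [x] with [W a = 0] also exists, and eliminating [b] between [W] and [V3] produces a
    cocircuit that misses both [a] and [b]. *)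
Lemma line_of_cover D a b :
  (forall x, x \in D -> exists V, [/\ V \in C, supp V \subset D & V x != None]) ->
  (forall V, V \in C -> supp V \subset D -> (V a != None) || (V b != None)) ->
  line D.
Proof.
move=> full cover x V1 V2 xD V1C V2C s1 s2 V1x V2x; apply/negPn/negP => n12.
have s12 V : supp V \subset supp V1 :|: supp V2 -> supp V \subset D /\ V x = None.
  move=> s; split; first by apply: subset_trans s _; rewrite subUset s1.
  by move/supp_subP: s; apply; rewrite !inE V1x V2x.
have [V [VC sV Vx Va]] : exists V, [/\ V \in C, supp V \subset D, V x = None & V a != None].
  case V1a: (V1 a) => [v|]; first by exists V1; rewrite V1a.
  case V2a: (V2 a) => [v|]; first by exists V2; rewrite V2a.
  have [W [WC sW Wb]] := cocircuit_avoid b V1C V2C n12.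
  have [sWD Wx] := s12 W sW.
  case/orP: (cover W WC sWD); rewrite ?Wb //.
  suff -> : W a = None by [].
  by move/supp_subP: sW; apply; rewrite !inE V1a V2a.
have [V3 [V3C sV3 V3a]] := cocircuit_avoid a V1C V2C n12.
have [sV3D V3x] := s12 _ sV3.
have V3b : V3 b != None by move: (cover V3 V3C sV3D); rewrite V3a.
have [W [WC sW Wa Wx]] : exists W, [/\ W \in C, supp W \subset D, W a = None & W x != None].
  have [W [WC sW Wx]] := full x xD.
  case Wa: (W a) => [w|]; last by exists W.
  have Wa' : W a != None by rewrite Wa.
  have [Z [ZC sZ Za Zx]] := cocircuit_strong_avoid WC VC Wa' Va Wx Vx.
  by exists Z; split=> //; apply: subset_trans sZ _; rewrite subUset sW.
have Wb : W b != None by move: (cover W WC sW); rewrite Wa.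
have [Z [ZC sZ Zb Zx]] := cocircuit_strong_avoid WC V3C Wb V3b Wx V3x.
have sZD : supp Z \subset D by apply: subset_trans sZ _; rewrite subUset sW.
move: (cover Z ZC sZD); rewrite Zb orbF; suff -> : Z a = None by [].
by move/supp_subP: sZ; apply; rewrite !inE Wa V3a.
Qed.

(** A coindependent subset of [D] omits some [a] of [X] and some [b] of a cocircuit vanishing at
    [a]. Conversely, if [V] vanishes at [x] but not at [y], each cocircuit of the line vanishing at
    [x] is parallel to [V], so [D :\ x :\ y] contains none. *)
Lemma line_corank X Y : X \in C -> Y \in C -> ~~ parallel X Y ->
  line (supp X :|: supp Y) ->
  corank C (supp X :|: supp Y) + 2 = #|supp X :|: supp Y|.
Proof.
move=> XC YC nXY; set D := _ :|: _ => lD.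
have sXD : supp X \subset D by apply: subsetUl.
have cardD2 a b : a \in D -> b \in D -> a != b -> #|D :\ a :\ b| + 2 = #|D|.
  move=> aD bD ab; rewrite (cardsD1 a D) aD (cardsD1 b (D :\ a)) in_setD1 eq_sym ab bD /=; lia.
apply/eqP; rewrite eqn_leq; apply/andP; split.
  have Dn : 2 <= #|D|.
    have [x Xx] := cocircuit_neq0 XC.
    have [V [VC sV Vx]] := cocircuit_avoid x XC YC nXY.
    have [y Vy] := cocircuit_neq0 VC.
    rewrite -(@cardD2 x y) ?leq_addl //.
    - by rewrite !inE Xx.
    - by apply: (subsetP sV); rewrite inE.
    by apply/eqP=> xy; rewrite -xy Vx in Vy.
  suff : corank C D <= #|D| - 2 by lia.
  apply/bigmax_leqP => T /andP[sT /forall_inP indT].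
  have [a aD aT] : exists2 a, a \in D & a \notin T.
    have := indT X XC; case/subsetPn => a aX aT; exists a => //.
    exact: (subsetP sXD).
  have [V [VC sV Va]] := cocircuit_avoid a XC YC nXY.
  have := indT V VC; case/subsetPn=> b bV bT.
  have ab : a != b by apply: contraTneq bV => <-; apply/suppPn.
  have bD : b \in D by apply: (subsetP sV).
  rewrite -(cardD2 a b) // addnK; apply: subset_leq_card.
  by rewrite !subsetD1 sT aT bT.
have [x Xx] := cocircuit_neq0 XC.
have xD : x \in D by rewrite !inE Xx.
have [V [VC sV Vx]] := cocircuit_avoid x XC YC nXY.
have [y Vy] := cocircuit_neq0 VC.
have yD : y \in D by apply: (subsetP sV); rewrite inE.
have xy : x != y by apply: contraNneq Vy => <-; rewrite Vx.
rewrite -(cardD2 x y) // leq_add2r.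
apply: (leq_bigmax_cond (D :\ x :\ y)).
rewrite subDset subsetU ?subD1set ?orbT //=.
apply/forall_inP=> W WC; apply/negP; rewrite !subsetD1 => /andP[/andP[sW /suppPn Wx] /suppPn Wy].
by move: Vy; rewrite (parallel_None (lD x W V xD WC VC sW sV Wx Vx) Wy).
Qed.

End Cocircuits.

(** Rank duality; the bounds [H] and [H2] make the truncated subtractions in [mrank] exact. *)
Lemma edge_rankE (E : finType) (C : {set svec E}) (A : {set E}) :
  (mrank C A + 2 == rankOM C) = (corank C (~: A) + 2 == #|~: A|).
Proof.
rewrite /rankOM /mrank setCT cardsT.
have -> : corank C set0 = 0.
  apply/eqP; rewrite -leqn0; apply/bigmax_leqP => T /andP[].
  by rewrite subset0 => /eqP-> _; rewrite cards0.
have H : corank C setT <= corank C (~: A) + #|A|.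
  apply/bigmax_leqP => T /andP[_ /forall_inP indT].
  rewrite -(cardsID A T) addnC leq_add //; last by rewrite subset_leq_card ?subsetIr.
  apply: (leq_bigmax_cond (T :\: A)); rewrite setDE subsetIr /=.
  apply/forall_inP=> Y YC; apply: contraNN (indT Y YC) => s.
  by apply: subset_trans s (subsetIl _ _).
have H2 : corank C (~: A) <= #|~: A| by apply/bigmax_leqP => T /andP[/subset_leq_card].
have H3 := cardsC A; apply/eqP/eqP; lia.
Qed.

Lemma comodular_line (E : finType) (C : {set svec E}) (X Y : svec E) : is_OM C ->
  X \in C -> Y \in C -> ~~ parallel X Y -> line C (supp X :|: supp Y) ->
  comodular C X Y.
Proof.
move=> OM XC YC nXY lD; move: (nXY); rewrite negb_or /comodular XC YC => /andP[-> ->] /=.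
rewrite /is_edge edge_rankE.
have -> : ~: zer (svcomp X Y) = supp X :|: supp Y.
  by rewrite -supp_svcomp; apply/setP=> e; rewrite !inE.
rewrite line_corank // eqxx andbT.
have mono : {homo covec_step C : A B / A \subset B}.
  move=> A B sAB; apply: setUS; apply/subsetP=> _ /imset2P[P Q PC QA ->].
  by apply: imset2_f => //; apply: (subsetP sAB).
have cov0 : sv0 E \in covectors C by rewrite /covectors -(fixsetK mono) !inE eqxx.
have covS P Q : P \in C -> Q \in covectors C -> svcomp P Q \in covectors C.
  by move=> PC QL; rewrite /covectors -(fixsetK mono) inE imset2_f ?orbT.
(* [X o Y = X o (Y o 0)] is reached from the zero covector in two steps. *)
have YE : svcomp Y (sv0 E) = Y by apply/ffunP=> e; rewrite !ffunE; case: (Y e).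
by apply: (covS) => //; rewrite -YE; apply: (covS).
Qed.

(** * Relations between cyclically consecutive terms of a sequence *)

Section Cyclic.
Variables (T : Type) (x0 : T).
Implicit Types (R : T -> T -> Prop) (s : seq T).

Definition cyclic R s :=
  forall i, i < size s -> R (nth x0 s i) (nth x0 s (i.+1 %% size s)).

Lemma cyclic_impl R R' s : (forall x y, R x y -> R' x y) -> cyclic R s -> cyclic R' s.
Proof. by move=> RR' H i /H /RR'. Qed.

Lemma cyclic_and R R' s : cyclic R s -> cyclic R' s -> cyclic (fun x y => R x y /\ R' x y) s.
Proof. by move=> H H' i lis; split; [apply: H|apply: H']. Qed.

Lemma cyclic_rev R s : cyclic R s -> cyclic (fun x y => R y x) (rev s).
Proof.
move=> H i; rewrite size_rev => lis.
have l' : i.+1 %% size s < size s by rewrite ltn_mod; lia.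
rewrite !nth_rev //; set j := i.+1 %% size s in l' *.
have := H (size s - j.+1); suff -> : (size s - j.+1).+1 %% size s = size s - i.+1.
  by apply; lia.
rewrite /j in l' *; have [e|ne] := eqVneq i.+1 (size s).
  (* Wrap-around: here [j = 0], and the last index is followed by 0. *)
  by rewrite e modnn subn1 prednK ?modnn ?subnn; lia.
by rewrite (@modn_small i.+1) ?modn_small; lia.
Qed.

Lemma cyclic_closed (P : T -> Prop) s i0 : i0 < size s -> P (nth x0 s i0) ->
  cyclic (fun x y => P x -> P y) s -> forall i, i < size s -> P (nth x0 s i).
Proof.
move=> li0 P0 H i lis.
have Pk k : P (nth x0 s ((i0 + k) %% size s)).
  elim: k => [|k IH]; first by rewrite addn0 modn_small.
  have lk : (i0 + k) %% size s < size s by rewrite ltn_mod; lia.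
  by move: (H _ lk IH); rewrite -addn1 modnDml addn1 addnS.
(* The number of steps from [i0] past the end of the sequence to [i]. *)
have := Pk (size s - i0 + i); rewrite addnA subnKC; last by lia.
by rewrite modnDl modn_small.
Qed.

End Cyclic.

Lemma cyclic_map (T U : Type) (x0 : T) (y0 : U) (f : T -> U) (R : U -> U -> Prop) s :
  cyclic x0 (fun x y => R (f x) (f y)) s -> cyclic y0 R (map f s).
Proof.
move=> H i; rewrite size_map => lis.
by rewrite !(nth_map x0) ?ltn_mod //; [apply: H|lia].
Qed.

(** * Edges of cocircuit graphs and eliminations along them *)

Section Edges.
Variables (E : finType) (C : {set svec E}).
Hypothesis OM : is_OM C.
Implicit Types (X Y V W Z : svec E) (D : {set E}) (e h x : E) (I J : seq (E * bool)).

Let Copp X : X \in C -> svopp X \in C. Proof. by case: OM => _ H _ _; apply: H. Qed.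

(** A rank-free form of the edges of a cocircuit graph, with no condition on [g]: it is stable under
    negation and serves all programs on [O] at once. *)
Definition cedge X Y := [/\ X \in C, Y \in C, conformal X Y, ~~ parallel X Y &
  line C (supp X :|: supp Y)].

(* For conformal [X] and [Y] this is the condition on [Z] in [elim_of C (svopp X) Y]. *)
Definition between X Y Z := forall h,
  (X h = None -> Z h = Y h) /\ (Y h = None -> Z h = omap negb (X h)).

Lemma betweenP X Y Z : conformal X Y ->
  (forall h, h \notin sep (svopp X) Y -> Z h = svcomp (svopp X) Y h) <-> between X Y Z.
Proof.
move/conformalP=> cXY; split=> H h.
  have := H h; rewrite !inE !ffunE.
  by case: (X h) => [x|]; case: (Y h) => [y|] //= -> //; rewrite ?eqxx.
have [] := H h; have := cXY h; rewrite !inE !ffunE.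
case: (X h) => [x|]; case: (Y h) => [y|] //=.
- by move=> /(_ isT isT) [->]; rewrite eqxx.
- by move=> _ _ ->.
- by move=> _ ->.
by move=> _ ->.
Qed.

Lemma cedge_sym X Y : cedge X Y -> cedge Y X.
Proof. by case=> *; split; rewrite // 1?conformal_sym 1?parallel_sym 1?setUC. Qed.

Lemma cedge_opp X Y : cedge X Y -> cedge (svopp X) (svopp Y).
Proof.
case=> XC YC /conformalP cXY nXY lD; split; rewrite ?Copp ?supp_svopp //.
  apply/conformalP=> e; have := cXY e; rewrite !ffunE.
  by case: (X e) => [x|] //; case: (Y e) => [y|] // /(_ isT isT) [->].
by rewrite parallel_oppr parallel_sym parallel_oppr parallel_sym.
Qed.

Lemma between_opp X Y Z : between X Y Z -> between (svopp X) (svopp Y) (svopp Z).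
Proof.
move=> H h; have [H1 H2] := H h; rewrite !ffunE; split=> hyp.
  by rewrite H1 //; case: (X h) hyp.
by rewrite H2 //; case: (Y h) hyp.
Qed.

Lemma between_swap X Y Z : between X Y Z -> between Y X (svopp Z).
Proof.
move=> H h; have [H1 H2] := H h; rewrite !ffunE; split=> hyp.
  by rewrite H2 //; case: (X h) => //= x; rewrite negbK.
by rewrite H1.
Qed.

Lemma between_supp X Y Z : between X Y Z -> supp Z \subset supp X :|: supp Y.
Proof.
move=> H; apply/supp_subP=> h; rewrite inE negb_or => /andP[/suppPn Xh /suppPn Yh].
by case: (H h) => ->.
Qed.

(** At an element of [X] outside [Y], every vector between them has entry [- X h]. This fixes the
    sign of a cocircuit known only up to opposite. *)
Lemma between_agree X Y Z W : cedge X Y -> between X Y Z -> between X Y W ->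
  exists2 h, W h = Z h & W h != None.
Proof.
case=> XC YC _ nXY _ bZ bW.
have [h Xh Yh] : exists2 h, X h != None & Y h = None.
  have : ~~ (supp X \subset supp Y).
    by apply: contraNN nXY; apply: (cocircuit_incomparable OM).
  by case/subsetPn=> h; rewrite inE => Xh /suppPn Yh; exists h.
have [_ /(_ Yh) Wh] := bW h; have [_ /(_ Yh) Zh] := bZ h.
by exists h; rewrite Wh ?Zh //; case: (X h) Xh.
Qed.

Lemma cedge_elim X Y e : cedge X Y -> X e != None -> X e = Y e ->
  exists W, [/\ W \in C, W e = None & between X Y W].
Proof.
case=> XC YC /conformalP cXY nXY lD Xe XYe.
have [|||W WC [We Wh]] := @cocircuit_elim _ _ OM (svopp X) Y e (Copp XC) YC.
- by rewrite parallel_sym parallel_oppr parallel_sym.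
- by rewrite ffunE; case: (X e) Xe.
- by rewrite ffunE XYe.
have sW : supp W \subset supp X :|: supp Y.
  apply/supp_subP=> h; rewrite inE negb_or => /andP[/suppPn Xh /suppPn Yh].
  by case: (Wh h) => ->; rewrite ?ffunE ?Xh.
(* A zero of [W] off [supp X :&: supp Y] would make [W] parallel to [X] or [Y]. *)
have W0 V h : V \in C -> supp V \subset supp X :|: supp Y ->
    h \in supp X :|: supp Y -> V e != None -> V h = None -> W h != None.
  move=> VC sV hD Ve Vh; apply: contraNneq Ve => Wh0.
  by rewrite (parallel_None (lD h W V hD WC VC sW sV Wh0 Vh) We).
exists W; split=> // h; split=> hyp.
  case Yh: (Y h) => [y|]; last by case: (Wh h) => ->; rewrite ?ffunE ?hyp ?Yh.
  have : W h != None.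
    by apply: (W0 X) => //; rewrite ?subsetUl ?inE ?Yh ?orbT.
  by case: (Wh h) => ->; rewrite ?ffunE ?hyp ?Yh.
case Xh: (X h) => [x|]; last by case: (Wh h) => ->; rewrite ?ffunE ?hyp ?Xh.
have : W h != None.
  by apply: (W0 Y) => //; rewrite ?subsetUr ?inE ?Xh -?XYe.
by case: (Wh h) => ->; rewrite ?ffunE ?hyp ?Xh.
Qed.

(* Two elements vanishing on the same cocircuit [W] of a line are parallel in
   the contraction, so their signs are correlated along the line. *)
Lemma line_sign D W X V e f : line C D -> e \in D -> f \in D ->
  [/\ W \in C, X \in C & V \in C] ->
  [/\ supp W \subset D, supp X \subset D & supp V \subset D] ->
  W e = None -> W f = None ->
  X e != None -> X f != None -> V e != None -> V f != None ->
  (X e == X f) = (V e == V f).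
Proof.
move=> lD eD fD [WC XC VC] [sW sX sV] We Wf.
have sub X1 X2 Z : supp X1 \subset D -> supp X2 \subset D ->
    (forall h, [\/ Z h = None, Z h = X1 h | Z h = X2 h]) -> supp Z \subset D.
  move=> /supp_subP s1 /supp_subP s2 H; apply/supp_subP=> h hD.
  by case: (H h) => ->; rewrite ?s1 ?s2.
have npar Z U : Z \in C -> U \in C -> parallel Z W -> U e != None ->
    (forall h, Z h = None \/ Z h = U h) -> False.
  move=> ZC UC ZW Ue H; suff ZU : parallel Z U.
    have Ze : Z e = None by apply: parallel_None We; rewrite parallel_sym.
    by rewrite (parallel_None ZU Ze) in Ue.
  apply: (cocircuit_incomparable OM) => //; apply/supp_subP=> h /suppPn Uh.
  by case: (H h) => ->.
(* Eliminating [f] between [X] and [U], and [e] between [X] and [-U], gives two cocircuits parallel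
   to [W]. If they are equal, their support lies in that of [X]; if opposite, in that of [U].
   Neither is possible, since [W e = 0]. *)
have aux U : U \in C -> supp U \subset D -> X e != None -> X f != None ->
    X e = U e -> X f = omap negb (U f) -> False.
  move=> UC sU Xe Xf XUe XUf.
  have nXU : ~~ parallel X U.
    rewrite /parallel; apply/negP=> /orP[] /eqP XU.
      by move: Xf; rewrite XU in XUf *; case: (U f) XUf => [[]|].
    by move: Xe; rewrite XU ffunE in XUe *; case: (U e) XUe => [[]|].
  have [W1 W1C [W1f H1]] := cocircuit_elim OM XC UC nXU Xf XUf.
  have UC' := Copp UC; have sU' : supp (svopp U) \subset D by rewrite supp_svopp.
  have [||W2 W2C [W2e H2]] := @cocircuit_elim _ _ OM X (svopp U) e XC UC' _ Xe.
  - by rewrite parallel_oppr.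
  - by rewrite ffunE XUe; case: (U e) => //= u; rewrite negbK.
  have p1 : parallel W1 W by apply: (lD f) => //; apply: sub H1.
  have p2 : parallel W2 W by apply: (lD e) => //; apply: sub H2.
  have : parallel W1 W2.
    case/orP: (p1) (p2) => /eqP-> /orP[] /eqP->.
    - by rewrite /parallel eqxx.
    - by rewrite parallel_oppr /parallel eqxx.
    - by rewrite parallel_sym parallel_oppr /parallel eqxx.
    by rewrite /parallel eqxx.
  case/orP=> /eqP W12.
    apply: (npar W1 X) => // h; move: (H1 h) (H2 h); rewrite -W12 ffunE.
    case=> ->; [by left|by right|case=> h2; [by left|by right|left]].
    by case: (U h) h2 => [[]|].
  apply: (npar W1 U) => //; first by rewrite -XUe.
  move=> h; move: (H1 h) (H2 h); rewrite W12 !ffunE.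
  case: (W2 h) => [w|] /=; last by left.
  case=> // h1; last by right.
  case=> // h2; right; first by move: h1; rewrite -h2; case: (w).
  by case: (U h) h2 => //= u [->]; rewrite negbK.
move=> Xe Xf Ve Vf.
(* A disagreement of [X] and [V] at [f] alone is excluded by [aux], one at [e] alone by [aux] for
   [-V]. *)
have [XVe|XVe] := eqVneq (X e) (V e); have [XVf|XVf] := eqVneq (X f) (V f).
- by rewrite XVe XVf.
- case: (aux V) => //.
  by case: (X f) Xf XVf => [[]|] // _; case: (V f) Vf => [[]|].
- case: (aux (svopp V)); rewrite ?Copp ?supp_svopp ?ffunE //.
    by case: (X e) Xe XVe => [[]|] // _; case: (V e) Ve => [[]|].
  by rewrite XVf; case: (V f) => [[]|].
by move: Xe Xf Ve Vf XVe XVf; case: (X e) => [[]|] //; case: (V e) => [[]|] //;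
   case: (X f) => [[]|] //; case: (V f) => [[]|].
Qed.

(* An edge [{X, Y}] of the program [(O u p, p, f)], with [Z] the restriction to [E]
   of the cocircuit eliminating [p] between [-X] and [Y]. *)
Definition parc I X Y Z := [/\ cedge X Y, lex_sigma I X = Some true,
  lex_sigma I Y = Some true, between X Y Z &
  (Z \in C /\ lex_sigma I Z = None) \/
  exists Y1 Y2, [/\ [/\ Y1 \in C, Y2 \in C, conformal Y1 Y2 & ~~ parallel Y1 Y2],
    lex_sigma I Y1 != None, lex_sigma I Y1 = omap negb (lex_sigma I Y2) &
    Z = svcomp Y1 Y2]].

Lemma lex_sigma_skip e a J X : X e = None -> lex_sigma ((e, a) :: J) X = lex_sigma J X.
Proof. by move=> /= ->. Qed.

Lemma parc_skip e a J X Y Z : X e = None -> Y e = None ->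
  parc ((e, a) :: J) X Y Z -> parc J X Y Z.
Proof.
move=> Xe Ye [cXY]; rewrite (lex_sigma_skip a J Xe) (lex_sigma_skip a J Ye) => sX sY bZ H.
have Ze : Z e = None by case: (bZ e) => ->.
split=> //; case: H => [[ZC sZ]|[Y1 [Y2 [H s1 s12 ZE]]]]; [left|right].
  by rewrite lex_sigma_skip in sZ.
have [Y1e Y2e] : Y1 e = None /\ Y2 e = None.
  by move: Ze; rewrite ZE ffunE; case: (Y1 e).
by exists Y1, Y2; rewrite !lex_sigma_skip in s1 s12.
Qed.

(** On the line, [W] is the only cocircuit vanishing at [e] that is conformal to [Z] and nonzero at
    [h]. If [Z = Y1 o Y2], then [Y1] and [Y2] are not both nonzero at [e], as conformality would
    give them the same sign at [p], and not both zero, as they would be parallel. So one of them is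
    [W] and the other is [V]. *)
Lemma parc_near e a J X Y Z W : parc ((e, a) :: J) X Y Z ->
  e \in supp X :|: supp Y -> W \in C -> supp W \subset supp X :|: supp Y ->
  W e = None -> (exists2 h, W h = Z h & W h != None) ->
  (Z = W /\ lex_sigma J W = None) \/
  exists V, [/\ V \in C, supp V \subset supp X :|: supp Y, V e != None &
    [/\ lex_sigma J W != None,
        lex_sigma ((e, a) :: J) V = omap negb (lex_sigma J W) & Z = svcomp W V]].
Proof.
move=> [[XC YC cXY nXY lD] sX sY bZ H] eD WC sW We [h WZ Wh].
have sZ := between_supp bZ.
have Wpar V : V \in C -> supp V \subset supp X :|: supp Y -> V e = None -> 
    V h = None \/ V h = Z h -> V = W.
  move=> VC sV Ve; have := lD e V W eD VC WC sV sW Ve We.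
  case/orP=> /eqP-> //; rewrite ffunE -WZ.
  by case: (W h) Wh => [[]|] // _ [].
have lexN V : lex_sigma ((e, a) :: J) V = None -> V e = None by rewrite /=; case: (V e).
case: H => [[ZC lZ]|[Y1 [Y2 [[Y1C Y2C c12 n12] s1 s12 ZE]]]]; [left|right].
  have ZW : Z = W by apply: Wpar => //; [apply: lexN|right].
  by rewrite -ZW; split=> //; rewrite -(@lex_sigma_skip e a) // lexN.
have sub12 : supp Y1 :|: supp Y2 \subset supp X :|: supp Y by rewrite -supp_svcomp -ZE.
have [sY1 sY2] : supp Y1 \subset supp X :|: supp Y /\ supp Y2 \subset supp X :|: supp Y.
  by apply/andP; rewrite -subUset.
have hE1 : Y1 h = None \/ Y1 h = Z h by rewrite ZE ffunE; case: (Y1 h); [right|left].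
have hE2 : Y2 h = None \/ Y2 h = Z h.
  by rewrite ZE svcompC // ffunE; case: (Y2 h); [right|left].
case Y1e: (Y1 e) => [y1|].
  case Y2e: (Y2 e) => [y2|].
    move/conformalP/(_ e): c12; rewrite Y1e Y2e => /(_ isT isT) [y12].
    by move: s12; rewrite /= Y1e Y2e y12; case: (a); case: (y2).
  have Y2W := Wpar _ Y2C sY2 Y2e hE2.
  exists Y1; split; rewrite ?Y1e //; split.
  - rewrite -Y2W -(@lex_sigma_skip e a) //.
    by move: s1; rewrite s12; case: (lex_sigma _ Y2).
  - by rewrite s12 -Y2W lex_sigma_skip.
  by rewrite ZE -Y2W svcompC.
have Y1W := Wpar _ Y1C sY1 Y1e hE1.
case Y2e: (Y2 e) => [y2|]; last first.
  by rewrite (lD e Y1 Y2) in n12.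
exists Y2; split; rewrite ?Y2e //; split.
- by rewrite -Y1W -(@lex_sigma_skip e a).
- rewrite -Y1W -(@lex_sigma_skip e a J Y1) // s12.
  by case: (lex_sigma _ Y2) => //= b; rewrite negbK.
by rewrite -Y1W.
Qed.

Lemma parc_elim e a J X Y Z W : parc ((e, a) :: J) X Y Z ->
  X e != None -> W \in C -> W e = None -> between X Y W ->
  (Z = W /\ lex_sigma J W = None) \/
  exists V, [/\ V \in C, supp V \subset supp X :|: supp Y, V e != None &
    [/\ lex_sigma J W != None,
        lex_sigma ((e, a) :: J) V = omap negb (lex_sigma J W) & Z = svcomp W V]].
Proof.
move=> parcZ Xe WC We bW; have [cXY _ _ bZ _] := parcZ.
apply: (parc_near parcZ) => //; first by rewrite !inE Xe.
  exact: between_supp bW.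
exact: between_agree bZ bW.
Qed.

End Edges.

(** * Cyclic sequences of edges in a Euclidean oriented matroid *)

Section EuclideanCycles.
Variables (E : finType) (C : {set svec E}).
Hypothesis euclC : euclidean_OM C.
Implicit Types (X Y V W Z : svec E) (e h : E) (I J : seq (E * bool)) (s : seq (svec E)).

Let OM : is_OM C. Proof. by case: euclC. Qed.
Let Copp X : X \in C -> svopp X \in C. Proof. by case: OM => _ H _ _; apply: H. Qed.
Local Notation cyclic := (cyclic (sv0 E)).

Definition all_elims e (P : svec E -> Prop) X Y :=
  forall W, W \in C -> W e = None -> between X Y W -> P W.

(** A single elimination with [W h = +] would make [s] a directed cycle of [(O, e, h)]. *)
Let euclid_cycle_pp s e h : uniq s -> cyclic (cedge C) s ->
  (forall X, X \in s -> X e = Some true) ->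
  cyclic (all_elims e (fun W => W h <> Some false)) s ->
  cyclic (all_elims e (fun W => W h = None)) s.
Proof.
move=> us edges se Wh i lis W WC We bW.
have [eh|neh] := eqVneq e h; first by rewrite -eh.
have memn j : nth (sv0 E) s (j %% size s) \in s by rewrite mem_nth // ltn_mod; lia.
have [cXC cYC cconf _ _] := edges i lis.
have Xe j : j < size s -> nth (sv0 E) s j e = Some true by move=> lj; rewrite se ?mem_nth.
(* If [h] is a coloop, [(O, e, h)] is not a program; but then cocircuits with nonzero [e]-entry
   vanish at [h], and so does [W]. *)
case: (boolP (is_coloop C h)) => [/exists_inP[F FC /eqP sF]|ncl].
  have s0 X : X \in C -> X e = Some true -> X h = None.
    move=> XC Xe1; case Xh: (X h) => [x|] //.
    have FX : parallel F X.
      by apply: (cocircuit_incomparable OM) => //; rewrite sF sub1set inE Xh.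
    have : e \notin supp F by rewrite sF inE.
    by move/suppPn/(parallel_None FX); rewrite Xe1.
  have [bWh _] := bW h; rewrite bWh ?s0 //; first by rewrite se.
  by rewrite Xe.
case Whc: (W h) => [w|] //; exfalso.
have Wht : W h = Some true.
  by move: (Wh i lis W WC We bW); rewrite Whc; case: (w).
have prog : is_program C e h.
  split=> //; apply/negP=> /forall_inP /(_ _ cXC); by rewrite Xe.
case: euclC => _ /(_ e h prog); apply; exists s.
have arc j U : j < size s -> U \in C -> U e = None ->
    between (nth (sv0 E) s j) (nth (sv0 E) s (j.+1 %% size s)) U ->
    gedge C e (nth (sv0 E) s j) (nth (sv0 E) s (j.+1 %% size s)) /\
    arrow_sign C e h (nth (sv0 E) s j) (nth (sv0 E) s (j.+1 %% size s)) (U h).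
  move=> lj UC Ue bU; have [XC YC cXY nXY lD] := edges j lj.
  split; last by exists U; split=> //; split=> //; apply/betweenP.
  by rewrite /gedge /vertex XC YC cXY (comodular_line OM) // Xe ?se.
split=> //.
- by case: (s) lis.
- move=> j lj; have edgej := edges j lj.
  have Xj : nth (sv0 E) s j e != None by rewrite Xe.
  have XYj : nth (sv0 E) s j e = nth (sv0 E) s (j.+1 %% size s) e by rewrite Xe ?se.
  have [U [UC Ue bU]] := cedge_elim OM edgej Xj XYj.
  have [ge ar] := arc j U lj UC Ue bU.
  have := Wh j lj U UC Ue bU; case Uh: (U h) ar => [[]|] ar // _; [left|right]; by split.
by exists i => //; rewrite /darc -Wht; apply: arc.
Qed.

(** Reversing the cycle negates the eliminations, which handles [c = false]. Negating all cocircuits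
    makes [e] positive and turns [c] into its opposite. *)
Lemma euclid_cycle s e h b c : uniq s -> cyclic (cedge C) s ->
  (forall X, X \in s -> X e = Some b) ->
  cyclic (all_elims e (fun W => W h <> Some (~~ c))) s ->
  cyclic (all_elims e (fun W => W h = None)) s.
Proof.
have swapW e' (P : option bool -> Prop) X Y :
    all_elims e' (fun W => P (W h)) X Y -> all_elims e' (fun W => P (omap negb (W h))) Y X.
  move=> H W WC We bW; have := H (svopp W); rewrite !ffunE; apply.
  - exact: Copp.
  - by rewrite We.
  exact: between_swap.
have oppW e' (P : option bool -> Prop) X Y : all_elims e' (fun W => P (W h)) X Y ->
    all_elims e' (fun W => P (omap negb (W h))) (svopp X) (svopp Y).
  move=> H W WC We bW; have := H (svopp W); rewrite !ffunE; apply.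
  - exact: Copp.
  - by rewrite We.
  by have := between_opp bW; rewrite !svoppK.
have negN o : omap negb o = None -> o = None by case: o.
have negS b' o : omap negb o <> Some (~~ b') -> o <> Some b'.
  by case: o => [a|] //= H [ab]; case: H; rewrite ab.
have pos d s' : uniq s' -> cyclic (cedge C) s' -> (forall X, X \in s' -> X e = Some true) ->
    cyclic (all_elims e (fun W => W h <> Some (~~ d))) s' ->
    cyclic (all_elims e (fun W => W h = None)) s'.
  case: d => //= us edges se H; first exact: euclid_cycle_pp.
  have : cyclic (all_elims e (fun W => W h = None)) (rev s').
    apply: euclid_cycle_pp; rewrite ?rev_uniq //.
    - by apply: (cyclic_rev (R := fun X Y => cedge C Y X));
        apply: cyclic_impl edges; apply: cedge_sym.
    - by move=> X; rewrite mem_rev; apply: se.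
    apply: (cyclic_rev (R := fun X Y => all_elims e (fun W => W h <> Some false) Y X)).
    apply: cyclic_impl H => X Y /(swapW e (fun o => o <> Some true)) H W.
    by move=> WC We bW; have := H W WC We bW; apply: (negS false).
  move=> H'; have := cyclic_rev H'; rewrite revK.
  apply: cyclic_impl => X Y /(swapW e (fun o => o = None)) H2 W.
  by move=> WC We bW; apply: negN; apply: H2.
case: b => us edges se H; first exact: pos H.
have : cyclic (all_elims e (fun W => W h = None)) (map (@svopp E) s).
  apply: (pos (~~ c)).
  - by rewrite map_inj_uniq //; apply: (can_inj (@svoppK E)).
  - by apply: (cyclic_map (x0 := sv0 E)); apply: cyclic_impl edges; apply: cedge_opp.
  - by move=> _ /mapP[X /se Xe ->]; rewrite ffunE Xe.
  apply: (cyclic_map (x0 := sv0 E)).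
  apply: cyclic_impl H => X Y /(oppW e (fun o => o <> Some (~~ c))) H W.
  by move=> WC We bW; have := H W WC We bW; rewrite negbK; apply: negS.
rewrite -[s in X in _ -> X](mapK (@svoppK E)) => H'; apply: (cyclic_map (x0 := sv0 E)).
apply: cyclic_impl H' => X Y /(oppW e (fun o => o = None)) H' W WC We bW.
by apply: negN; apply: H'.
Qed.

(** The first element [h] of [J] is never of the sign that would give [c], so it vanishes on all
    eliminations by [euclid_cycle], and the tail of [J] takes over. *)
Lemma lex_sigma_elims J s e b c : uniq s -> cyclic (cedge C) s ->
  (forall X, X \in s -> X e = Some b) ->
  cyclic (all_elims e (fun W => lex_sigma J W <> Some c)) s ->
  cyclic (all_elims e (fun W => lex_sigma J W = None)) s.
Proof.
move=> us edges se; elim: J => [|[h a] J IH] H.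
  by apply: cyclic_impl H => X Y _ W.
have Wh0 : cyclic (all_elims e (fun W => W h = None)) s.
  apply: (euclid_cycle (c := a (+) c) us edges se).
  apply: cyclic_impl H => X Y H W WC We bW Wh; have := H W WC We bW.
  by rewrite /= Wh; case: (a); case: (c).
have : cyclic (all_elims e (fun W => lex_sigma J W <> Some c)) s.
  apply: cyclic_impl (cyclic_and H Wh0) => X Y [H1 H2] W WC We bW.
  by have := H1 W WC We bW; rewrite /= H2.
move/IH => H'; apply: cyclic_impl (cyclic_and H' Wh0) => X Y [H1 H2] W WC We bW.
by rewrite /= H2 ?H1.
Qed.

(** A positive [f]-entry propagates forward: conformality forbids [-] next, and 0 next would give
    [Z f = -]. Without positive entries zeros propagate, since [X f = 0] gives [Z f = Y f]; all
    entries being 0 contradicts [Z0 f = +]. *)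
Lemma constant_f_sign I f s i0 Z0 :
  cyclic (fun X Y => exists2 Z, parc C I X Y Z & Z f <> Some false) s ->
  i0 < size s ->
  parc C I (nth (sv0 E) s i0) (nth (sv0 E) s (i0.+1 %% size s)) Z0 ->
  Z0 f = Some true ->
  exists c, forall i, i < size s -> nth (sv0 E) s i f = Some c.
Proof.
move=> arcs li0 [_ _ _ b0 _] Z0f.
case: (boolP (has (fun X => X f == Some true) s)) => [|/hasPn noT].
  case/(has_nthP (sv0 E)) => i lis /eqP Xf; exists true.
  apply: (cyclic_closed (P := fun X => X f = Some true) lis Xf).
  apply: cyclic_impl arcs => X Y [Z [[_ _ /conformalP cXY _ _] _ _ bZ _] Zf] Xf1.
  case Yf: (Y f) => [y|]; first by rewrite -Yf -(cXY f) ?Xf1 ?Yf.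
  by case: Zf; have [_ ->] := bZ f; rewrite ?Xf1.
have noT' i : i < size s -> nth (sv0 E) s i f <> Some true.
  by move=> lis; apply/eqP; rewrite noT ?mem_nth.
have l1 i : i.+1 %% size s < size s by rewrite ltn_mod; lia.
exists false => i lis; case Xf: (nth (sv0 E) s i f) => [[]|] //.
  by case: (noT' i lis).
have all0 : forall j, j < size s -> nth (sv0 E) s j f = None.
  apply: (cyclic_closed (P := fun X => X f = None) lis Xf).
  move=> j lj Xj; have [Z [_ _ _ bZ _] Zf] := arcs j lj.
  have [/(_ Xj) Zf' _] := bZ f; have := noT' _ (l1 j); move: Zf; rewrite Zf'.
  by case: (nth (sv0 E) s (j.+1 %% size s) f) => [[]|].
by have [+ _] := b0 f; rewrite Z0f !all0 // => /(_ erefl).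
Qed.

(** Here [Y] itself is the cocircuit of the line vanishing at [e], so [Z] is [Y] or [Y o V]. *)
Lemma parc_mixed_r e a J X Y Z f : parc C ((e, a) :: J) X Y Z ->
  X e != None -> Y e = None -> Y f != None -> Z f = Y f.
Proof.
move=> parcZ Xe Ye Yf; have [[XC YC _ _ _] _ _ bZ _] := parcZ.
have : ~~ (supp Y \subset supp X).
  apply: contraNN Xe => sYX.
  by rewrite (parallel_None (cocircuit_incomparable OM YC XC sYX) Ye).
case/subsetPn=> h; rewrite inE => Yh /suppPn Xh.
have YZ : exists2 h, Y h = Z h & Y h != None by exists h => //; have [->] := bZ h.
have eD : e \in supp X :|: supp Y by rewrite !inE Xe.
have [[-> //]|[V [_ _ _ [_ _ ->]]]] := parc_near parcZ eD YC (subsetUr _ _) Ye YZ.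
by rewrite ffunE; case: (Y f) Yf.
Qed.

(** The same with [-X] as the cocircuit vanishing at [e]. *)
Lemma parc_mixed_l e a J X Y Z f : parc C ((e, a) :: J) X Y Z ->
  X e = None -> Y e != None -> X f != None -> Z f = omap negb (X f).
Proof.
move=> parcZ Xe Ye Xf; have [[XC YC _ _ _] _ _ bZ _] := parcZ.
have : ~~ (supp X \subset supp Y).
  apply: contraNN Ye => sXY.
  by rewrite (parallel_None (cocircuit_incomparable OM XC YC sXY) Xe).
case/subsetPn=> h; rewrite inE => Xh /suppPn Yh.
have XZ : exists2 h, svopp X h = Z h & svopp X h != None.
  by exists h; rewrite ffunE; [have [_ ->] := bZ h|case: (X h) Xh].
have eD : e \in supp X :|: supp Y by rewrite !inE Ye orbT.
have sX : supp (svopp X) \subset supp X :|: supp Y by rewrite supp_svopp subsetUl.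
have Xe' : svopp X e = None by rewrite ffunE Xe.
have [[-> _]|[V [_ _ _ [_ _ ->]]]] := parc_near parcZ eD (Copp XC) sX Xe' XZ.
  by rewrite ffunE.
by rewrite !ffunE; case: (X f) Xf.
Qed.

(* Vertices with zero [e]-entry lie at infinity of the affine space [e = a], infinitely
   high or low with respect to [f] according to the constant sign [c]; a monotone
   cycle cannot both leave them and reach them. *)
Lemma no_mixed_cycle e a J f s c :
  cyclic (fun X Y => exists2 Z, parc C ((e, a) :: J) X Y Z & Z f <> Some false) s ->
  (forall i, i < size s -> nth (sv0 E) s i f = Some c) ->
  has (fun X => X e != None) s ->
  forall X, X \in s -> X e = Some a.
Proof.
move=> arcs sf /(has_nthP (sv0 E)) [i0 li0 Xi0].
have l1 i : i < size s -> i.+1 %% size s < size s by rewrite ltn_mod; lia.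
have nonzero i : i < size s -> nth (sv0 E) s i e != None.
  (* For [c = +], leaving [e = 0] would give [Z f = -], so zeros propagate; for [c = -], entering
     [e = 0] would, so nonzero entries propagate. *)
  case: c sf => sf lis.
    apply/eqP=> Xe0.
    have : nth (sv0 E) s i0 e = None; last by move=> X0; rewrite X0 in Xi0.
    apply: (cyclic_closed (P := fun X => X e = None) lis Xe0) li0 => j lj Xj.
    have [Z parcZ Zf] := arcs j lj; apply/eqP/negPn/negP => Yj.
    by case: Zf; rewrite (parc_mixed_l parcZ Xj Yj) sf.
  apply: (cyclic_closed (P := fun X => X e != None) li0 Xi0) lis => j lj Xj.
  have [Z parcZ Zf] := arcs j lj; apply/eqP=> Yj.
  by case: Zf; rewrite (parc_mixed_r parcZ Xj Yj) sf ?l1.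
move=> X /(nthP (sv0 E)) [i lis <-]; have [Z [_ + _ _ _] _] := arcs i lis.
have := nonzero i lis; rewrite /=; case: (nth (sv0 E) s i e) => [x|] // _ [].
by case: (a); case: (x).
Qed.

(** Induction on [I]: a leading element vanishing on the whole cycle is dropped, and the empty list
    admits no [parc], its [lex_sigma] never being [+]. *)
Lemma no_lex_cycle I f s : uniq s ->
  cyclic (fun X Y => exists2 Z, parc C I X Y Z & Z f <> Some false) s ->
  forall i Z, i < size s ->
  parc C I (nth (sv0 E) s i) (nth (sv0 E) s (i.+1 %% size s)) Z -> Z f <> Some true.
Proof.
move=> us; elim: I => [|[e a] J IH] arcs i0 Z0 li0 parc0 Z0f; first by case: parc0.
have l1 i : i < size s -> i.+1 %% size s < size s by rewrite ltn_mod; lia.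
case: (boolP (has (fun X => X e != None) s)) => [se|/hasPn se0]; last first.
  have se i : i < size s -> nth (sv0 E) s i e = None.
    by move=> lis; apply/eqP/negPn; apply: se0; rewrite mem_nth.
  case: (IH _ i0 Z0) => //; last by apply: parc_skip parc0; rewrite se ?l1.
  move=> i lis; have [Z parcZ Zf] := arcs i lis.
  by exists Z => //; apply: parc_skip parcZ; rewrite se ?l1.
have [c sf] := constant_f_sign arcs li0 parc0 Z0f.
have sea := no_mixed_cycle arcs sf se.
have sea' i : i < size s -> nth (sv0 E) s i e = Some a.
  by move=> lis; rewrite sea ?mem_nth.
have edges : cyclic (cedge C) s by apply: cyclic_impl arcs => X Y [Z []].
have Xe i : i < size s -> nth (sv0 E) s i e != None by move=> lis; rewrite sea'.
have Wf0 : cyclic (all_elims e (fun W => W f = None)) s.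
  apply: (euclid_cycle (c := true) us edges sea) => i lis W WC We bW Wf.
  have [Z parcZ Zf] := arcs i lis; apply: Zf.
  have [[-> //]|[V [_ _ _ [_ _ ->]]]] := parc_elim OM parcZ (Xe i lis) WC We bW.
  by rewrite ffunE Wf.
(* [f] and [e] being parallel on each line, [Z f] is [- c] times [lex_sigma J W]. *)
have WJ : cyclic (all_elims e (fun W => lex_sigma J W <> Some c)) s.
  move=> i lis W WC We bW Wc; have [Z parcZ Zf] := arcs i lis.
  have Wf := Wf0 i lis W WC We bW.
  have [[_]|[V [VC sV Ve [_ lV ZE]]]] := parc_elim OM parcZ (Xe i lis) WC We bW.
    by rewrite Wc.
  have [XC _ _ _ lD] := edges i lis.
  have eD : e \in supp (nth (sv0 E) s i) :|: supp (nth (sv0 E) s (i.+1 %% size s)).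
    by rewrite !inE Xe.
  have fD : f \in supp (nth (sv0 E) s i) :|: supp (nth (sv0 E) s (i.+1 %% size s)).
    by rewrite !inE sf.
  have sW := between_supp bW.
  have Vf : V f != None.
    apply: contraNneq Ve => Vf; apply/eqP.
    exact: parallel_None (lD f W V fD WC VC sW sV Wf Vf) We.
  have Xf : nth (sv0 E) s i f != None by rewrite sf.
  (* With signs read as numbers, [V e * V f = a * c] by comparison with [X], while [a * V e = - c];
     hence [V f = -1], contradicting [Zf]. *)
  have := line_sign OM lD eD fD (And3 WC XC VC) (And3 sW (subsetUl _ _) sV) We Wf
    (Xe i lis) Xf Ve Vf.
  move: Zf lV Ve Vf; rewrite ZE ffunE Wf Wc sea' // sf //=.
  case: (V e) => [v|] // ; case: (V f) => [[]|] //.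
  by case: (a); case: (v); case: (c).
have WJ0 := lex_sigma_elims us edges sea WJ.
have [W [WC We bW]] : exists W, [/\ W \in C, W e = None &
    between (nth (sv0 E) s i0) (nth (sv0 E) s (i0.+1 %% size s)) W].
  by apply: (cedge_elim OM (edges i0 li0) (Xe i0 li0)); rewrite !sea' ?l1.
have [[ZW _]|[V [_ _ _ [+ _ _]]]] := parc_elim OM parc0 (Xe i0 li0) WC We bW.
  by move: Z0f; rewrite ZW (Wf0 i0 li0 W).
by rewrite (WJ0 i0 li0 W).
Qed.

End EuclideanCycles.

(** * Restriction of the lexicographic extension to [E] *)

Section LexExtension.
Variables (E : finType) (C : {set svec E}) (I : seq (E * bool)).
Hypothesis OM : is_OM C.
Implicit Types (X Y V W : svec E) (D T : {set E}) (P Q Z : svec (option E)).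

Local Notation C' := (lex_ext C I).
Local Notation sigma := (lex_sigma I).

Let Copp X : X \in C -> svopp X \in C. Proof. by case: OM => _ H _ _; apply: H. Qed.

Definition res Z : svec E := [ffun e => Z (Some e)].

Lemma lex_sigma_opp X : sigma (svopp X) = omap negb (sigma X).
Proof.
elim: I => [|[e a] J IH] //=; rewrite ffunE IH.
by case: (X e) => //= b; case: (a).
Qed.

Lemma ext_sv_res X b : res (ext_sv X b) = X.
Proof. by apply/ffunP=> e; rewrite !ffunE. Qed.

Lemma res_inj P Q : P None = Q None -> res P = res Q -> P = Q.
Proof.
move=> PQ0 PQ; apply/ffunP=> [[e|]] //.
by move/ffunP/(_ e): PQ; rewrite !ffunE.
Qed.

Lemma lex_ext_old X : X \in C -> ext_sv X (sigma X) \in C'.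
Proof. by move=> XC; apply/setUP; left; apply/imsetP; exists X. Qed.

Lemma lex_ext_new X Y : X \in C -> Y \in C -> conformal X Y -> comodular C X Y ->
  sigma X != None -> sigma X = omap negb (sigma Y) -> ext_sv (svcomp X Y) None \in C'.
Proof.
move=> XC YC cXY mXY sX sXY; apply/setUP; right.
by apply/imset2P; exists X Y => //; rewrite inE YC cXY mXY sX sXY eqxx.
Qed.

Lemma lex_extP Z : Z \in C' ->
  (res Z \in C /\ Z None = sigma (res Z)) \/
  Z None = None /\ exists X Y, [/\ [/\ X \in C, Y \in C, conformal X Y & ~~ parallel X Y],
    sigma X != None, sigma X = omap negb (sigma Y) & res Z = svcomp X Y].
Proof.
case/setUP=> [/imsetP[X XC ->]|/imset2P[X Y XC H ->]]; [left|right].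
  by rewrite ext_sv_res ffunE.
move: H; rewrite inE => /and5P[YC cXY /and5P[_ _ nXY nXY' _] sX /eqP sXY].
split; first by rewrite ffunE.
by exists X, Y; rewrite ext_sv_res; split=> //; split=> //; rewrite negb_or nXY.
Qed.

(** Unsigned elimination of [p] in [O u p], derived from the construction of its cocircuits. *)
Lemma p_elim T V1 V2 : V1 \in C -> V2 \in C -> supp V1 \subset T -> supp V2 \subset T ->
  ~~ parallel V1 V2 ->
  exists Z, [/\ Z \in C', Z None = None & supp (res Z) \subset T].
Proof.
have [n] := ubnP #|T|; elim: n T V1 V2 => // n IH T V1 V2 /ltnSE-len V1C V2C sV1 sV2 n12.
(* [T] is shrunk until it is a line, where conformal nonparallel cocircuits are comodular. *)
case: (boolP [exists x in T, exists V in C, exists W in C,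
  [&& supp V \subset T :\ x, supp W \subset T :\ x & ~~ parallel V W]]).
  case/exists_inP=> x xT /exists_inP[V VC /exists_inP[W WC /and3P[sV sW nVW]]].
  have [|Z [ZC Z0 sZ]] := IH (T :\ x) V W _ VC WC sV sW nVW.
    by move: len; rewrite (cardsD1 x) xT.
  by exists Z; split=> //; apply: subset_trans sZ (subD1set _ _).
move/exists_inPn=> noline.
have lT : line C T.
  move=> x V W xT VC WC sV sW Vx Wx; apply/negPn/negP=> nVW.
  case/negP: (noline x xT); apply/exists_inP; exists V => //.
  apply/exists_inP; exists W => //.
  by rewrite !subsetD1 sV sW nVW !andbT; apply/andP; split; apply/suppPn.
have none V : V \in C -> supp V \subset T -> sigma V = None ->
    exists Z, [/\ Z \in C', Z None = None & supp (res Z) \subset T].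
  move=> VC sV sig; exists (ext_sv V (sigma V)).
  by rewrite lex_ext_old // ext_sv_res ffunE.
(* Induction on the separation. Eliminating a separating [h] gives [U] with [sigma U] zero, or
   opposite to that of [V] or of [W]; in the latter cases [U] replaces the other cocircuit and [h]
   no longer separates. *)
have opposite m V W : #|sep V W| < m -> V \in C -> W \in C -> supp V \subset T ->
    supp W \subset T -> ~~ parallel V W -> sigma V != None ->
    sigma V = omap negb (sigma W) ->
    exists Z, [/\ Z \in C', Z None = None & supp (res Z) \subset T].
  elim: m V W => // m IHm V W /ltnSE-lem VC WC sV sW nVW sgV sgVW.
  have [cVW|] := boolP (conformal V W).
    exists (ext_sv (svcomp V W) None); split; rewrite ?ffunE //.
      apply: lex_ext_new => //; apply: comodular_line => // x A B xD AC BC sA sB.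
      have sD : supp V :|: supp W \subset T by rewrite subUset sV.
      by apply: lT => //; [apply: (subsetP sD)|apply: subset_trans sD|apply: subset_trans sD].
    by rewrite ext_sv_res supp_svcomp subUset sV.
  case/set0Pn=> h hVW; move: (hVW); rewrite inE => /andP[Vh /eqP VWh].
  have [U UC [Uh HU]] := cocircuit_elim OM VC WC nVW Vh VWh.
  have sU : supp U \subset T.
    apply/supp_subP=> k kT; have /supp_subP/(_ k kT) Vk := sV.
    by have /supp_subP/(_ k kT) Wk := sW; case: (HU k) => ->.
  have nU (A : svec E) : A h != None -> ~~ parallel U A.
    by move=> Ah; apply: contraNN Ah => /parallel_None ->.
  have Wh : W h != None by move: Vh; rewrite VWh; case: (W h).
  have less (A B : svec E) : (forall k, k \in sep A B -> k \in sep V W) -> h \notin sep A B ->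
      #|sep A B| < m.
    move=> sAB hAB; apply: leq_trans lem; apply/proper_card/properP; split.
      exact/subsetP.
    by exists h.
  case sgU: (sigma U) => [z|]; last exact: none sgU.
  have [eqz|neqz] := eqVneq (sigma U) (sigma V).
    apply: (IHm U W); rewrite ?nU ?eqz //.
    apply: less; last by rewrite inE Uh.
    move=> k; rewrite !inE => /andP[Uk /eqP UWk]; case: (HU k) => Uk'.
    - by rewrite Uk' in Uk.
    - by rewrite -Uk' Uk UWk eqxx.
    by move: Uk UWk; rewrite Uk'; case: (W k) => [[]|].
  apply: (IHm V U); rewrite ?[parallel V U]parallel_sym ?nU //.
    apply: less; last by rewrite inE Uh andbC; case: (V h) Vh.
    move=> k; rewrite !inE => /andP[Vk /eqP VUk]; case: (HU k) => Uk'.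
    - by move: Vk; rewrite VUk Uk'.
    - by move: Vk VUk; rewrite Uk'; case: (V k) => [[]|].
    by rewrite -Uk' -VUk Vk eqxx.
  by move: neqz sgV; rewrite sgU; case: (sigma V) => [[]|] //; case: (z).
case s1: (sigma V1) => [b|]; last exact: none s1.
case s2: (sigma V2) => [d|]; last exact: none s2.
have [bd|bd] := eqVneq b d.
  apply: (opposite _ V1 (svopp V2) (ltnSn _)); rewrite ?Copp ?supp_svopp ?parallel_oppr ?s1 //.
  by rewrite lex_sigma_opp s2 bd /= negbK.
apply: (opposite _ V1 V2 (ltnSn _)); rewrite ?s1 ?s2 //.
by case: (b) bd; case: (d).
Qed.

Lemma lex_ext_vertex Z : vertex C' None Z -> res Z \in C /\ sigma (res Z) = Some true.
Proof. by case/andP=> /lex_extP[[ZC ->] /eqP|[-> _]]. Qed.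

Lemma lex_ext_neq0 Z : Z \in C' -> exists e, Z (Some e) != None.
Proof.
case/lex_extP=> [[ZC _]|[_ [X [Y [[XC YC cXY nXY] sX sXY ZE]]]]].
  by have [e] := cocircuit_neq0 OM ZC; rewrite ffunE; exists e.
have [e Xe] := cocircuit_neq0 OM XC; exists e.
by move/ffunP/(_ e): ZE; rewrite !ffunE => ->; case: (X e) Xe.
Qed.

(** The edge condition gives two elements of [D] and [p] that together meet every cocircuit of
    [O u p] supported there. If both lie in [E], [line_of_cover] applies; otherwise [p] must be
    exchanged for an element of [E]. *)
Lemma lex_ext_cedge P Q : gedge C' None P Q -> cedge C (res P) (res Q).
Proof.
case/and4P=> vP vQ /conformalP cPQ /and5P[PC QC nPQ nPQ' eF].
have [XC sX] := lex_ext_vertex vP; have [YC sY] := lex_ext_vertex vQ.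
have P0 : P None = Some true by case/andP: vP => _ /eqP.
have Q0 : Q None = Some true by case/andP: vQ => _ /eqP.
split=> //.
- by apply/conformalP=> e; rewrite !ffunE; apply: cPQ.
- apply/negP=> /orP[] /eqP XY.
    by case/eqP: nPQ; apply: res_inj; rewrite ?P0.
  by move: sX; rewrite XY lex_sigma_opp sY.
set D := _ :|: _.
case/andP: eF => _; rewrite edge_rankE; set D' := ~: _.
have D'E o : (o \in D') = (if o is Some e then e \in D else true).
  rewrite !inE ffunE; case: o => [e|]; last by rewrite P0.
  by rewrite !inE !ffunE; case: (P (Some e)).
have subD' Z : supp (res Z) \subset D -> supp Z \subset D'.
  move=> /supp_subP sZ; apply/supp_subP=> [[e|]]; rewrite D'E //.
  by move/sZ; rewrite ffunE.
have [T /andP[sT /forall_inP indT] ->] :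
    {T : {set option E} | (T \subset D') && coindep C' T & corank C' D' = #|T|}.
  apply: (eq_bigmax_cond (A := fun T : {set option E} => (T \subset D') && coindep C' T)).
  apply/card_gt0P; exists set0; rewrite unfold_in sub0set /=.
  apply/forall_inP=> Z /lex_ext_neq0[e Ze]; apply/subsetPn; exists (Some e); by rewrite inE.
move/eqP=> cardT.
have : #|D' :\: T| == 2.
  by have := cardsID T D'; rewrite (setIidPr sT) -cardT => /eqP; rewrite eqn_add2l.
case/cards2P=> a' [b' [nab DT]].
have cover Z : Z \in C' -> supp (res Z) \subset D -> (Z a' != None) || (Z b' != None).
  move=> ZC /subD' sZ; have /subsetPn[o oZ oT] := indT Z ZC.
  have : o \in D' :\: T by rewrite inE oT (subsetP sZ).
  by rewrite DT !inE => /orP[] /eqP oE; move: oZ; rewrite oE inE => ->; rewrite ?orbT.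
have full x : x \in D -> exists V, [/\ V \in C, supp V \subset D & V x != None].
  rewrite !in_setU => /orP[] xX; [exists (res P)|exists (res Q)]; rewrite inE in xX;
    by split=> //; rewrite ?subsetUl ?subsetUr.
(* By [p_elim], two nonparallel cocircuits in [D :\ b] would yield one of [O u p] missing [p] and
   [b]. So at most one, [V0], vanishes at [b] up to sign, and any [a] in its support replaces
   [p]. *)
have coverS b : (forall Z, Z \in C' -> supp (res Z) \subset D ->
    (Z None != None) || (Z (Some b) != None)) -> line C D.
  move=> coverb.
  case: (pickP (fun V => [&& V \in C, supp V \subset D & V b == None])) => [V0|noV0].
    case/and3P=> V0C sV0 /eqP V0b; have [a V0a] := cocircuit_neq0 OM V0C.
    apply: (line_of_cover OM (a := a) (b := b)) => // V VC sV.
    case Vb: (V b) => [v|]; first by rewrite orbT.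
    have [VV0|nVV0] := boolP (parallel V V0).
      by rewrite orbF; apply: contraNneq V0a => /(parallel_None VV0) ->.
    have sub W : supp W \subset D -> W b = None -> supp W \subset D :\ b.
      by move=> sW Wb; rewrite subsetD1 sW; apply/suppPn.
    have [Z [ZC Z0]] := p_elim VC V0C (sub _ sV Vb) (sub _ sV0 V0b) nVV0.
    rewrite subsetD1 => /andP[sZ /suppPn]; rewrite ffunE => Zb.
    by move: (coverb Z ZC sZ); rewrite Z0 Zb.
  apply: (line_of_cover OM (a := b) (b := b)) => // V VC sV.
  by move: (noV0 V); rewrite VC sV /= => ->.
case: a' b' nab cover {DT} => [a|] [b|] // _ cover; last exact: (coverS b).
  apply: (line_of_cover OM (a := a) (b := b)) => // V VC sV.
  have := cover _ (lex_ext_old VC); rewrite ext_sv_res !ffunE; exact.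
by apply: (coverS a) => Z ZC sZ; rewrite orbC cover.
Qed.

Lemma lex_ext_parc P Q Z : gedge C' None P Q -> elim_of C' (svopp P) Q None Z ->
  parc C I (res P) (res Q) (res Z).
Proof.
move=> gPQ [ZC Z0 eZ]; have cPQ := lex_ext_cedge gPQ.
case/and4P: gPQ => /lex_ext_vertex[_ sX] /lex_ext_vertex[_ sY] confPQ _.
split=> //.
  by move=> h; rewrite !ffunE; move/(betweenP Z confPQ): eZ; apply.
case/lex_extP: ZC => [[rZ]|[_ [X [Y H]]]]; last by right; exists X, Y.
by rewrite Z0; left.
Qed.

End LexExtension.

Theorem theorem1p1 (E : finType) (C : {set {ffun E -> option bool}})
    (I : seq (E * bool)) (f : E) :
  euclidean_OM C ->
  uniq (map fst I) ->
  ~~ is_loop (lex_ext C I) None ->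
  ~~ is_coloop (lex_ext C I) (Some f) ->
  euclidean_program (lex_ext C I) None (Some f).
Proof.
move=> euclC _ _ _ [s [_ us arcs [i lis [gi [Z [eZ Zf]]]]]].
have OM : is_OM C by case: euclC.
have edge_arcs j : j < size s -> exists2 Z, parc C I (res (nth (sv0 _) s j))
    (res (nth (sv0 _) s (j.+1 %% size s))) Z & Z f <> Some false.
  by move=> lj; case: (arcs j lj) => -[gj [U [eU Uf]]]; exists (res U);
    rewrite ?ffunE ?Uf //; apply: lex_ext_parc gj eU.
(* All vertices have entry [+] at [p], so restriction to [E] is injective on them. *)
have us' : uniq (map (@res E) s).
  rewrite map_inj_in_uniq // => P Q Ps Qs; apply: res_inj.
  have s1 R : R \in s -> R None = Some true.
    case/(nthP (sv0 _)) => j lj <-.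
    by case: (arcs j lj) => -[/and4P[/andP[_ /eqP ->]]].
  by rewrite !s1.
have lis1 : i.+1 %% size s < size s by rewrite ltn_mod; lia.
apply: (@no_lex_cycle E C euclC I f _ us' _ i (res Z)).
- have := @cyclic_map _ _ (sv0 _) (sv0 E) (@res E) (fun X Y =>
    exists2 Z, parc C I X Y Z & Z f <> Some false) s; exact.
- by rewrite size_map.
- by rewrite size_map !(nth_map (sv0 _)) //; apply: lex_ext_parc gi eZ.
by rewrite ffunE.
Qed.
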